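(* Let $N \in \mathbb{N}$, let $\mathbb{K}$ be a field, let $A_1, \ldots, A_N$ be finite subsets of $\mathbb{K}$, let $Q := A_1 \times \cdots \times A_N$, and let $p \in \mathbb{K}[X_1, \ldots, X_N]$ be a polynomial with $\deg_{X_i}(p) < |A_i|$ for all $i \in \{1,\ldots,N\}$. Assume that there is $\mathbf{c} \in Q$ such that $p(\mathbf{c}) \neq 0$. Then for every $\mathbf{a} \in (A_1 \setminus \{0\}) \times \cdots \times (A_N \setminus \{0\})$, there is $\mathbf{b} \in Q$ with $p(\mathbf{b}) \neq 0$ and \[ d_H(\mathbf{a}, \mathbf{b}) \le \log_2(M(p)). \]
   Context: $\mathbb{N}$ denotes the set of positive integers. $\deg_{X_i}(p)$ is the degree of $p$ in the variable $X_i$. $M(p)$ denotes the number of monomials that appear in $p$ with nonzero coefficient. For $\mathbf{a}, \mathbf{b} \in \mathbb{K}^N$, the Hamming distance is $d_H(\mathbf{a}, \mathbf{b}) := \#\{ i \in \{1,\ldots,N\} \mid a_i \neq b_i \}$. *)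

(* Defs.v *)
From Stdlib Require Import Reals.
From mathcomp Require Import all_boot all_order all_algebra.
From mathcomp Require Import finmap.
From mathcomp.multinomials Require Import mpoly.

Set Implicit Arguments.
Unset Strict Implicit.
Unset Printing Implicit Defensive.

Import GRing.Theory.

(* Both Stdlib's R_scope and MathComp's ring_scope claim the key %R; keep %R
   for ring_scope and use %coqR for the classical real numbers. *)
Delimit Scope ring_scope with R.
Delimit Scope R_scope with coqR.

Local Open Scope nat_scope.

(* The zero polynomial gets degree 0 in every variable. *)
Definition degX (N : nat) (K : fieldType) (i : 'I_N) (p : {mpoly K[N]}) : nat :=
  \max_(m <- msupp p) m i.

Definition nmonomials (N : nat) (K : fieldType) (p : {mpoly K[N]}) : nat :=
  size (msupp p).

Definition hamming (N : nat) (K : fieldType) (a b : {ffun 'I_N -> K}) : nat :=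
  #|[set i : 'I_N | a i != b i]|.

(* Main.v *)
(** Eliminate the variables one at a time.  If [p] stays nonzero when
    [X_i := a_i], set [b_i := a_i]; the number of monomials does not grow.
    Otherwise group the monomials of [p] by their exponents off [i]: each group
    is a nonzero univariate polynomial in [X_i] vanishing at [a_i != 0], hence
    has at least two terms.  Any [c] in [A_i] for which [X_i := c] does not kill
    [p] (one exists by the degree bound) then at least halves the number of
    monomials, which pays for the one extra coordinate where [b] leaves [a]. *)
Require Import Defs.
From Stdlib Require Import Reals Lra.
From mathcomp Require Import all_boot all_order all_algebra.
From mathcomp Require Import finmap.
From mathcomp.multinomials Require Import mpoly.

Set Implicit Arguments.
Unset Strict Implicit.
Unset Printing Implicit Defensive.

Delimit Scope ring_scope with R.
Delimit Scope R_scope with coqR.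

Local Open Scope fset_scope.
Local Open Scope ring_scope.

Import GRing.Theory.

(** Double counting: as [u] has no repetition, each [x] in [s] lies over at most one [y]. Used with
    [k = 1] and [k = 2] to compare numbers of monomials. *)
Lemma leq_mul_size_fibres (T U : eqType) (f : T -> U) (k : nat)
    (s : seq T) (u : seq U) :
  uniq u -> (forall y, y \in u -> (k <= count (fun x => f x == y) s)%N) ->
  (k * size u <= size s)%N.
Proof.
move=> uu hk; have -> : (k * size u = \sum_(y <- u) k)%N.
  by rewrite big_const_seq count_predT iter_addn_0.
apply: (@leq_trans (\sum_(y <- u) \sum_(x <- s | f x == y) 1)%N).
  by rewrite big_seq [leqRHS]big_seq; apply: leq_sum => y /hk; rewrite sum1_count.
rewrite (exchange_big_dep predT) //= -(sum1_size s); apply: leq_sum => x _.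
rewrite sum1_count (eq_count (a2 := pred1 (f x))); last by move=> y; rewrite /= eq_sym.
by rewrite count_uniq_mem // leq_b1.
Qed.

Definition upd (N : nat) (T : Type) (i : 'I_N) (c : T) (b : {ffun 'I_N -> T}) :=
  [ffun j => if j == i then c else b j].

Section Specialization.

Variables (N : nat) (K : fieldType) (i : 'I_N).
Implicit Types (p : {mpoly K[N]}) (m : 'X_{1..N}) (c : K).

(** The exponent at [i] is zeroed rather than dropped, so that all variable eliminations take place
    in one ring with [N] fixed. *)
Definition mnm_off m : 'X_{1..N} :=
  [multinom (if j == i then 0%N else m j) | j < N].

Definition specX c p : {mpoly K[N]} :=
  \sum_(m <- msupp p) (p@_m * c ^+ m i) *: 'X_[mnm_off m].

(** The coefficient of [m0] when [p] is read as a polynomial in the other variables over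
    [K[X_i]]. *)
Definition fibre p m0 : {poly K} :=
  \sum_(m <- msupp p | mnm_off m == m0) p@_m *: 'X^(m i).

Lemma mnm_off_inj m m' : mnm_off m = mnm_off m' -> m i = m' i -> m = m'.
Proof.
move=> /mnmP eo ei; apply/mnmP => j; have := eo j; rewrite !mnmE.
by case: eqP => [->|].
Qed.

(** The bridge to one variable: [specX c p] vanishes exactly when [c] is a root of every fibre. *)
Lemma mcoeff_specX c p m0 : (specX c p)@_m0 = (fibre p m0).[c].
Proof.
rewrite /specX /fibre raddf_sum horner_sum [RHS]big_mkcond /=.
apply: eq_bigr => m _; rewrite mcoeffZ mcoeffX.
by case: eqP => _; rewrite ?mulr1 ?mulr0 // hornerZ hornerXn.
Qed.

Lemma mevalE_specX c p (b : {ffun 'I_N -> K}) :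
  (specX c p).@[b] = p.@[upd i c b].
Proof.
rewrite /specX raddf_sum [in RHS]mevalE /=; apply: eq_bigr => m _.
rewrite mevalZ mevalX -mulrA; congr (_ * _).
rewrite (bigD1 i) //= [in RHS](bigD1 i) //= mnmE eqxx expr0 mul1r ffunE eqxx.
congr (_ * _); apply: eq_bigr => j /negbTE ji.
by rewrite mnmE ffunE ji.
Qed.

(** By [mnm_off_inj], distinct monomials of one fibre have distinct exponents at [i], so no terms
    merge or cancel. *)
Lemma coef_fibre p m : (fibre p (mnm_off m))`_(m i) = p@_m.
Proof.
rewrite /fibre coef_sum.
have [mp|mp] := boolP (m \in msupp p); last first.
  rewrite (memN_msupp_eq0 mp) big_seq_cond big1 // => m' /andP[m'p /eqP e].
  rewrite coefZ coefXn; case: eqP => [ei|]; last by rewrite mulr0.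
  by rewrite -(mnm_off_inj e (esym ei)) m'p in mp.
rewrite -big_filter (bigD1_seq m) ?mem_filter ?eqxx ?filter_uniq ?msupp_uniq //=.
rewrite coefZ coefXn eqxx mulr1 big_filter_cond big1 ?addr0 // => m' /andP[/eqP e ne].
rewrite coefZ coefXn; case: eqP => [ei|]; last by rewrite mulr0.
by rewrite (mnm_off_inj e (esym ei)) eqxx in ne.
Qed.

Lemma leq_degX p m j : m \in msupp p -> (m j <= degX j p)%N.
Proof.
move=> mp; rewrite /degX (big_rem m) //=; exact: leq_maxl.
Qed.

Lemma size_fibre p m0 : (size (fibre p m0) <= (degX i p).+1)%N.
Proof.
rewrite /fibre big_seq_cond; apply: (big_ind (fun q : {poly K} => size q <= _)%N).
- by rewrite size_poly0.
- by move=> q r hq hr; rewrite (leq_trans (size_polyD _ _)) // geq_max hq.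
- move=> m /andP[mp _]; rewrite (leq_trans (size_scale_leq _ _)) // size_polyXn.
  by rewrite ltnS leq_degX.
Qed.

Lemma msupp_specX c p m0 : m0 \in msupp (specX c p) ->
  exists2 m, m \in msupp p & mnm_off m = m0.
Proof.
rewrite mcoeff_msupp mcoeff_specX /fibre => h.
have /hasP[m mp /eqP e] : has (fun m => mnm_off m == m0) (msupp p).
  apply: contraNT h => /hasPn h; rewrite big_seq_cond big_pred0 ?horner0 // => m.
  by apply/negP => /andP[/h /negP].
by exists m.
Qed.

Lemma degX_specX_le c p j : (degX j (specX c p) <= degX j p)%N.
Proof.
rewrite {1}/degX; apply/bigmax_leqP_seq => m0 /msupp_specX [m mp <-] _.
by rewrite mnmE; case: eqP => // _; apply: leq_degX.
Qed.

Lemma degX_specX c p : degX i (specX c p) = 0%N.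
Proof.
apply/eqP; rewrite -leqn0; apply/bigmax_leqP_seq => m0 /msupp_specX [m mp <-] _.
by rewrite mnmE eqxx.
Qed.

Lemma nmonomials_specX_le c p : (nmonomials (specX c p) <= nmonomials p)%N.
Proof.
rewrite -(mul1n (nmonomials (specX c p))).
apply: (@leq_mul_size_fibres _ _ mnm_off); first exact: msupp_uniq.
by move=> m0 /msupp_specX [m mp e]; rewrite -has_count; apply/hasP; exists m; rewrite ?e /=.
Qed.

Lemma nmonomials_specX_double a c p : a != 0 -> specX a p = 0 ->
  (2 * nmonomials (specX c p) <= nmonomials p)%N.
Proof.
move=> a0 pa; apply: (@leq_mul_size_fibres _ _ mnm_off); first exact: msupp_uniq.
move=> m0; rewrite mcoeff_msupp mcoeff_specX => hc.
have ha : (fibre p m0).[a] = 0 by rewrite -mcoeff_specX pa mcoeff0.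
move: hc ha; rewrite /fibre -big_filter -size_filter.
have : {subset [seq m <- msupp p | mnm_off m == m0] <= msupp p}.
  by move=> m; rewrite mem_filter => /andP[].
(* An empty fibre would vanish at [c]; a single term has a nonzero value at [a], since [a != 0]. *)
case: filter => [|m [|//]] sub; first by rewrite big_nil horner0 eqxx.
have := sub m (mem_head _ _); rewrite mcoeff_msupp => pm _.
rewrite big_seq1 hornerZ hornerXn => /eqP.
by rewrite mulf_eq0 (negbTE pm) expf_eq0 (negbTE a0) andbF.
Qed.

(** The fibre through a support monomial is nonzero of degree below the size of [S], so some point
    of [S] is not a root of it. *)
Lemma specX_neq0 p (S : {fset K}) : p != 0 -> (degX i p < #|` S|)%N ->
  exists2 c, c \in S & specX c p != 0.
Proof.
move=> p0 hS; have [m mp] : exists m, m \in msupp p.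
  by exists (mlead p); apply: mlead_supp.
have f0 : fibre p (mnm_off m) != 0.
  apply: contraTneq mp => f0; rewrite mcoeff_msupp negbK.
  by rewrite -coef_fibre f0 coef0.
have /hasP[c cS hc] : has (fun c => specX c p != 0) (enum_fset S).
  apply: contraLR hS => /hasPn h; rewrite -leqNgt -ltnS.
  apply: leq_trans (size_fibre p (mnm_off m)).
  apply: max_poly_roots f0 _ (fset_uniq S).
  apply/allP => c /h; rewrite negbK => /eqP e.
  by rewrite /root -mcoeff_specX e mcoeff0.
by exists c.
Qed.

End Specialization.

Lemma degX0_const (N : nat) (K : fieldType) (p : {mpoly K[N]}) :
  (forall i, degX i p = 0%N) -> p = (p@_0)%:MP.
Proof.
move=> h; apply/mpolyP => m; rewrite mcoeffC.
have [<-|m0] := eqVneq 0%MM m; first by rewrite mulr1.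
rewrite mulr0; apply: memN_msupp_eq0; apply: contra m0 => mp.
apply/eqP/mnmP => j; rewrite mnmE; apply/esym/eqP.
by rewrite -leqn0 -(h j) leq_degX.
Qed.

Lemma hamming_upd_id (N : nat) (K : fieldType) (i : 'I_N) (a b : {ffun 'I_N -> K}) :
  (hamming a (upd i (a i) b) <= hamming a b)%N.
Proof.
apply: subset_leq_card; apply/subsetP => j; rewrite !inE ffunE.
by case: (j =P i) => [->|]; rewrite ?eqxx.
Qed.

(** Only [i] can join the set of coordinates where the two points differ. *)
Lemma hamming_upd (N : nat) (K : fieldType) (i : 'I_N) (c : K)
    (a b : {ffun 'I_N -> K}) :
  (hamming a (upd i c b) <= (hamming a b).+1)%N.
Proof.
apply: (@leq_trans #|i |: [set j | a j != b j]|); last first.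
  by rewrite cardsU1 -add1n leq_add2r leq_b1.
apply: subset_leq_card; apply/subsetP => j; rewrite !inE ffunE.
by case: (j =P i).
Qed.

Lemma upd_family (N : nat) (K : fieldType) (A : 'I_N -> {fset K}) (i : 'I_N)
    (c : K) (b : {ffun 'I_N -> K}) :
  c \in A i -> b \in family A -> upd i c b \in family A.
Proof.
move=> cA /familyP bA; apply/familyP => j; rewrite ffunE.
by case: eqP => [->|_]; [exact: cA | exact: bA].
Qed.

(** Induction on [s], a list containing every variable that still occurs in [p]. The bound is kept
    free of logarithms, so halving the monomials matches one more differing coordinate. *)
Lemma nonzero_near (N : nat) (K : fieldType) (A : 'I_N -> {fset K})
    (a : {ffun 'I_N -> K}) (s : seq 'I_N) (p : {mpoly K[N]}) :
  a \in family (fun i => A i `\ 0) ->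
  p != 0 -> (forall i, (degX i p < #|` A i|)%N) ->
  (forall i, i \notin s -> degX i p = 0%N) ->
  exists b : {ffun 'I_N -> K},
    [/\ b \in family A, p.@[b] != 0 & (2 ^ hamming a b <= nmonomials p)%N].
Proof.
move=> /familyP ha.
have ha0 i : a i != 0 by have := ha i; rewrite in_fsetD1 => /andP[].
have haA i : a i \in A i by have := ha i; rewrite in_fsetD1 => /andP[].
elim: s p => [|i s IH] p p0 hA hs.
  (* No variable is left: [p] is a nonzero constant and [a] itself serves. *)
  exists a; split; first exact/familyP.
    have e := degX0_const (fun i => hs i (negbT (in_nil i))).
    by rewrite e mevalC; apply: contra p0 => /eqP e0; rewrite e e0 mpolyC0.
  have -> : hamming a a = 0%N.
    by apply/eqP; rewrite cards_eq0; apply/eqP/setP => j; rewrite !inE eqxx.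
  by rewrite expn0 lt0n size_eq0 msupp_eq0.
(* Common to both cases: a point found for [specX i c p] becomes one for [p] once its coordinate [i]
   is overwritten by [c]. *)
have step c : c \in A i -> specX i c p != 0 -> exists b : {ffun 'I_N -> K},
    [/\ upd i c b \in family A, p.@[upd i c b] != 0
      & (2 ^ hamming a b <= nmonomials (specX i c p))%N].
  move=> cA q0; have [|j|b [bA qb hb]] := IH _ q0.
  - by move=> j; apply: leq_ltn_trans (degX_specX_le _ _ _ _) (hA j).
  - have [->|ji] := eqVneq j i => js; first exact: degX_specX.
    apply/eqP; rewrite -leqn0 -(hs j) ?degX_specX_le //.
    by rewrite inE negb_or ji.
  - by exists b; rewrite upd_family // -mevalE_specX.
have [qa|qa] := eqVneq (specX i (a i) p) 0.
  have [c cA q0] := specX_neq0 p0 (hA i).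
  have [b [bA pb hb]] := step c cA q0; exists (upd i c b); split=> //.
  (* The factor 2 gained here pays for a possible disagreement at [i]. *)
  apply: leq_trans (nmonomials_specX_double c (ha0 i) qa).
  apply: (@leq_trans (2 ^ (hamming a b).+1)).
    by rewrite leq_exp2l // hamming_upd.
  by rewrite expnS leq_mul2l.
have [b [bA pb hb]] := step _ (haA i) qa; exists (upd i (a i) b); split=> //.
apply: leq_trans (leq_trans hb (nmonomials_specX_le i (a i) p)).
by rewrite leq_exp2l // hamming_upd_id.
Qed.

Lemma INR_le_Rlog2 (h n : nat) :
  (2 ^ h <= n)%N -> (INR h <= Rlog 2 (INR n))%coqR.
Proof.
move=> /leP /le_INR le2.
have e : INR (2 ^ h)%N = Rpower 2 (INR h).
  rewrite Rpower_pow; last by lra.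
  by elim: h {le2} => [//|h IH]; rewrite expnS mult_INR IH.
have pos : (0 < Rpower 2 (INR h))%coqR by apply: exp_pos.
have ln2 : (0 < ln 2)%coqR by rewrite -ln_1; apply: ln_increasing; lra.
have -> : INR h = Rlog 2 (Rpower 2 (INR h)).
  by rewrite /Rlog /Rpower ln_exp; field; lra.
rewrite /Rlog /Rdiv; apply: Rmult_le_compat_r.
  by apply/Rlt_le/Rinv_0_lt_compat.
(* [ln_increasing] is strict, so the case of equality is split off. *)
rewrite e in le2; have [lt|<-] := Rle_lt_or_eq_dec _ _ le2; last exact: Rle_refl.
by apply: Rlt_le; apply: ln_increasing.
Qed.

Theorem theorem5p3 (N : nat) (hN : (0 < N)%N) (K : fieldType)
    (A : 'I_N -> {fset K}) (p : {mpoly K[N]})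
    (hdeg : forall i : 'I_N, (degX i p < #|` A i|)%N)
    (hp : exists2 c : {ffun 'I_N -> K}, c \in family A & p.@[c] != 0) :
  forall a : {ffun 'I_N -> K}, a \in family (fun i => A i `\ 0) ->
  exists b : {ffun 'I_N -> K},
    [/\ b \in family A, p.@[b] != 0
      & (INR (hamming a b) <= Rlog 2 (INR (nmonomials p)))%coqR].
Proof.
move=> a ha; have p0 : p != 0.
  by case: hp => c _; apply: contraNneq => ->; rewrite meval0.
(* With all variables listed, the condition on variables outside [s] is vacuous. *)
have [|b [bA pb hb]] := nonzero_near (s := enum 'I_N) ha p0 hdeg.
  by move=> i; rewrite mem_enum.
by exists b; split=> //; apply: INR_le_Rlog2.
Qed.
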